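(* For a Tychonoff space $X$, the space $C_p(X)$ admits a fundamental bounded resolution if and only if $X$ is countable (equivalently, exactly when $C_p(X)$ is metrizable).
   Context: $C_p(X)$ is the space of continuous real-valued functions on $X$ with the pointwise topology. Order $\mathbb{N}^{\mathbb{N}}$ pointwise. A fundamental bounded resolution of a locally convex space $F$ is a family $\{B_\alpha:\alpha\in\mathbb{N}^{\mathbb{N}}\}$ of bounded sets covering $F$ with $B_\alpha\subseteq B_\beta$ whenever $\alpha\le\beta$ such that every bounded subset of $F$ is contained in some $B_\alpha$. *)

(* Defs.v *)
From HB Require Import structures.
From mathcomp Require Import all_boot all_order all_algebra.
From mathcomp Require Import all_classical all_reals all_analysis.
Set Implicit Arguments. Unset Strict Implicit. Unset Printing Implicit Defensive.
Import Order.TTheory GRing.Theory Num.Theory.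
Import numFieldNormedType.Exports.
Local Open Scope classical_set_scope.
Local Open Scope ring_scope.

Definition tychonoff_space (X : topologicalType) : Prop :=
  completely_regular_space X /\ accessible_space X.

Definition Cp (X : topologicalType) (R : realType) : set (X -> R) :=
  [set f : X -> R | continuous f].

(* Von Neumann boundedness of a set B of C_p(X), the topology being the
   pointwise one ({ptws X -> R}); a neighbourhood of 0 in the subspace C_p(X)
   is the trace of a neighbourhood of 0 in R^X, so (for B inside C_p(X)) it
   suffices to quantify over neighbourhoods of 0 in {ptws X -> R}. *)
Definition Cp_bounded (X : topologicalType) (R : realType) (B : set (X -> R)) : Prop :=
  B `<=` @Cp X R /\
  forall U : set {ptws X -> R}, nbhs ((fun _ : X => 0 : R) : {ptws X -> R}) U ->
    exists2 s : R, 0 < s &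
      forall t : R, s < `|t| -> B `<=` [set (fun x => t * u x) | u in U].

Definition le_NN (a b : nat -> nat) : Prop := forall n, (a n <= b n)%N.

Definition fundamental_bounded_resolution (X : topologicalType) (R : realType)
    (B : (nat -> nat) -> set (X -> R)) : Prop :=
  [/\ (forall a, Cp_bounded (B a)),
      \bigcup_a B a = @Cp X R,
      (forall a b, le_NN a b -> B a `<=` B b) &
      (forall A, Cp_bounded A -> exists a, A `<=` B a)].

(* Main.v *)
(** Bounded subsets of C_p(X) are the pointwise bounded sets of continuous
    functions, so for countable X the families |f x| <= a (code x) work.

    Conversely, a diagonal argument shows that for each a and x some finite
    prefix s of a is such that |f x| <= |s| for all f in all B b with b
    extending s.  Attach to x the set of all prefixes s with this property: a
    point of the second countable space of subsets of a countable set.  If X is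
    uncountable, for some x infinitely many points have attached sets agreeing
    with that of x at every finite stage, so there are points y_k whose attached
    sets converge to that of x; complete regularity lets us choose them together
    with continuous functions h_k of pairwise disjoint supports and
    h_k(y_k) = k.  The set of all h_k is bounded, hence inside some B a; but
    convergence gives one bound for B a at y_k for all large k. *)
Require Import Defs.
From mathcomp Require Import all_boot all_order all_algebra.
From mathcomp Require Import all_classical all_reals all_analysis.
From mathcomp Require Import lra.
Set Implicit Arguments. Unset Strict Implicit. Unset Printing Implicit Defensive.
Import Order.TTheory GRing.Theory Num.Theory.
Import numFieldNormedType.Exports.
Local Open Scope classical_set_scope.
Local Open Scope ring_scope.

(** One direction tests boundedness on the neighbourhood of functions of modulus below 1 at [x]. In
    the other, the functions [t^-1 * f] with [f] in [B] tend to 0 at each point, uniformly over [B],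
    as [t] grows. *)
Lemma Cp_boundedP (X : topologicalType) (R : realType) (B : set (X -> R)) :
  Cp_bounded B <->
  B `<=` @Cp X R /\ forall x, exists M : R, forall f, B f -> `|f x| <= M.
Proof.
split=> -[BC HB]; split=> //.
- move=> x.
  have cvx : {ptws, nbhs ((fun=> 0) : {ptws X -> R}) --> ((fun=> 0) : X -> R)}.
    exact: cvg_id.
  have cv0 := (pointwise_cvgP _ _).1 cvx x.
  have U1 := cv0 (nbhs_filter _) _ (nbhsx_ballx (0 : R) 1 ltr01).
  have [s s0 Hs] := HB _ U1.
  exists (`|s + 1|) => f Bf.
  have : s < `|s + 1| by rewrite ger0_norm; lra.
  move=> /Hs /(_ _ Bf) [u]; rewrite /= /ball /= sub0r normrN => u1 <-.
  by rewrite normrM ler_piMr// ltW.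
- move=> U nU.
  (* The sets [D s] generate a filter; its pointwise convergence to 0 puts some [D s] inside [U],
     with no need to describe basic neighbourhoods. *)
  pose D (s : R) : set (X -> R) :=
    [set u | exists t f, [/\ s < `|t|, B f & u = (fun x => t^-1 * f x)]].
  pose F : set_system (X -> R) := filter_from [set s : R | 0 < s] D.
  have FF : Filter F.
    apply: filter_from_filter; first by exists 1 => /=.
    move=> i j /= i0 j0; exists (Num.max i j); first by rewrite /= lt_max i0.
    move=> u [t [f [+ Bf ->]]]; rewrite gt_max => /andP[ti tj].
    by split; exists t, f.
  have /(_ _ nU) [s /= s0 DU] : {ptws, F --> ((fun=> 0) : X -> R)}.
    apply/pointwise_cvgP => x; apply/cvgrPdist_lt => e e0 /=.
    have [M HM] := HB x.
    exists (`|M| / e + 1) => /=; first by rewrite ltr_wpDl// divr_ge0// ltW.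
    move=> _ [t [f [tM Bf ->]]] /=.
    have t0 : 0 < `|t| by apply: lt_trans tM; rewrite ltr_wpDl// divr_ge0// ltW.
    rewrite sub0r normrN normrM normfV mulrC ltr_pdivrMr//.
    apply: (le_lt_trans (HM _ Bf)); apply: (le_lt_trans (ler_norm _)).
    rewrite -ltr_pdivrMl// mulrC; apply: le_lt_trans tM; lra.
  exists s => // t st f Bf; exists (fun x => t^-1 * f x).
    by apply: DU; exists t, f.
  apply/funext => x; rewrite mulrA divff ?mul1r//.
  by rewrite -normr_gt0 (lt_trans s0).
Qed.

(** Otherwise functions unbounded at [x] come from indices agreeing with [a] on longer and longer
    prefixes; one index dominates all of these, against the boundedness of its set. *)
Lemma uniform_bound_on_prefix (X : topologicalType) (R : realType)
    (B : (nat -> nat) -> set (X -> R)) :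
  fundamental_bounded_resolution B ->
  forall a x, exists n : nat, forall b f,
    (forall i, (i < n)%N -> b i = a i) -> B b f -> `|f x| <= n%:R.
Proof.
case=> bB _ mB _ a x; apply: contrapT => /forallNP H.
have /choice[F FP] : forall n : nat, exists bf : (nat -> nat) * (X -> R),
    [/\ forall i, (i < n)%N -> bf.1 i = a i, B bf.1 bf.2 & n%:R < `|bf.2 x|].
  move=> n; have /existsNP[b /existsNP[f]] := H n.
  move=> /not_implyP[ba /not_implyP[Bf /negP]]; rewrite -ltNge => nf.
  by exists (b, f).
(* A maximum over [n <= i] is enough: for [n > i] the [n]-th index takes the value [a i] at [i],
   which the second summand covers. *)
pose g i := (\max_(n < i.+1) (F n).1 i + a i)%N.
have Bg n : B g (F n).2.
  have [ba BF _] := FP n; apply: mB BF => i; rewrite /g.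
  have [/ba ->|ni] := ltnP i n; first exact: leq_addl.
  apply: leq_trans (leq_addr _ _).
  exact: (@leq_bigmax _ (fun m : 'I_i.+1 => (F m).1 i) (Ordinal (ni : n < i.+1)%N)).
have /Cp_boundedP[_ /(_ x)[M HM]] := bB g.
have [_ _] := FP (Num.truncn M).+1.
apply/negP; rewrite -leNgt (le_trans (HM _ (Bg _)))//.
exact/ltW/truncnS_gt.
Qed.

(** Classes are coded by finite boolean sequences, so there are countably many; if each point had a
    finite class at some stage, these classes would cover [X] by a countable set. *)
Lemma uncountable_infinite_classes (X : Type) (T : nat -> X -> Prop) :
  ~ countable [set: X] ->
  exists x, forall n,
    infinite_set [set y | forall c, (c < n)%N -> T c y <-> T c x].
Proof.
move=> ncX; apply: contrapT => /forallNP H; apply: ncX.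
pose sig n y := [seq `[< T c y >] | c <- iota 0 n].
pose cl (p : seq bool) := [set y | sig (size p) y = p].
have sP n x : cl (sig n x) = [set y | forall c, (c < n)%N -> T c y <-> T c x].
  rewrite /cl size_map size_iota; apply/seteqP; split=> y /=.
    move=> /eq_in_map E c cn; have := E c; rewrite mem_iota => /(_ cn) {}E.
    by split=> /asboolP; [rewrite E|rewrite -E] => /asboolP.
  move=> E; apply/eq_in_map => c; rewrite mem_iota => cn.
  by apply/asbool_equiv_eq; exact: E.
apply: (@sub_countable _ _ _ (\bigcup_(p in [set p | countable (cl p)]) cl p)).
  apply: subset_card_le => x _.
  have /existsNP[n /contrapT] := H x; rewrite -sP => fn.
  exists (sig n x); first exact: finite_set_countable.
  by rewrite sP.
exact: bigcup_countable.
Qed.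

(* Recursion on a function u whose support meets every C n in an infinite set:
   a function f separating two points of the support in C k splits it into
   {f < 2/3} and {f > 1/3}, one of which keeps this property because C is
   decreasing; the bump is put on the other side. *)
Lemma disjoint_bumps (R : realType) (X : topologicalType) (C : nat -> set X) :
  tychonoff_space X -> (forall n, C n.+1 `<=` C n) ->
  (forall n, infinite_set (C n)) ->
  exists (x : nat -> X) (g : nat -> X -> R),
    [/\ forall k, C k (x k), forall k, continuous (g k),
        forall k, g k (x k) != 0 &
        forall j k y, j != k -> g j y * g k y = 0].
Proof.
move=> [crX /accessible_closed_set1 cl1] decC infC.
have mC m n : (m <= n)%N -> C n `<=` C m.
  by elim: n m => [|n IH] m; [rewrite leqn0 => /eqP->|
    rewrite leq_eqVlt => /predU1P[->//|/IH mn]; apply: subset_trans mn].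
pose ok (u : X -> R) := continuous u /\
  forall n, infinite_set (C n `&` [set y | u y != 0]).
have step (k : nat) (u : {u | ok u}) :
    exists q : X * (X -> R) * {u | ok u},
      [/\ C k q.1.1, continuous q.1.2, q.1.2 q.1.1 != 0,
          forall y, sval u y = 0 -> q.1.2 y = 0 /\ sval q.2 y = 0 &
          forall y, q.1.2 y * sval q.2 y = 0].
  case: u => u [cu iu] /=.
  have /infinite_setN0[p [Cp up]] := iu k.
  have [q [[Cq uq] /= pq]] : (C k `&` [set y | u y != 0] `\ p) !=set0.
    exact/infinite_setN0/infinite_setD.
  have /(uniform_separatorP (R := R))[f [cf _ fp fq]] :=
    crX p [set q] (cl1 q) (fun e : p = q => pq (esym e)).
  have {}fp : f p = 0 by apply: fp; exists p.
  have {}fq : f q = 1 by apply: fq; exists q.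
  pose bump (h : X -> R) y := u y * Num.max 0 (h y).
  have cbump (h : X -> R) : continuous h -> continuous (bump h).
    move=> ch y; apply: cvgM; first exact: cu.
    have : continuous ((fun=> 0 : R) \max h).
      by apply: max_fun_continuous => // z; exact: cvg_cst.
    exact.
  (* The bump uses the positive part of [h] and the remaining function its negative part, so their
     product is 0. *)
  have split_at x (h : X -> R) : continuous h -> C k x -> u x != 0 -> 0 < h x ->
      (forall n, infinite_set (C n `&` [set y | u y != 0 /\ h y < 0])) ->
      exists q : X * (X -> R) * {u | ok u},
        [/\ C k q.1.1, continuous q.1.2, q.1.2 q.1.1 != 0,
            forall y, u y = 0 -> q.1.2 y = 0 /\ sval q.2 y = 0 &
            forall y, q.1.2 y * sval q.2 y = 0].
    move=> ch Cx ux hx hinf.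
    have okh : ok (bump (fun y => - h y)).
      split; first by apply: cbump => y; apply: cvgN; exact: ch.
      move=> n; apply: sub_infinite_set (hinf n) => y [Cy [uy hy]]; split=> //=.
      by rewrite mulf_neq0// max_r ?oppr_ge0 ?oppr_eq0 ?lt_eqF// ltW.
    exists (x, bump h, exist ok _ okh); split=> //=.
    - exact: cbump.
    - by rewrite mulf_neq0// max_r ?gt_eqF// ltW.
    - by move=> y u0; rewrite /bump u0 !mul0r.
    - move=> y; rewrite /bump; have [h0|_] := leP 0 (h y).
        by rewrite [Num.max _ (- _)]max_l ?oppr_le0// !mulr0.
      by rewrite mulr0 mul0r.
  pose E1 := [set y | u y != 0 /\ f y - 2 / 3 < 0].
  pose E2 := [set y | u y != 0 /\ 1 / 3 - f y < 0].
  have [inf1|] := pselect (forall n, infinite_set (C n `&` E1)).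
    apply: (split_at q (fun y => f y - 2 / 3)) => //; last by rewrite fq; lra.
    by move=> y; apply: cvgB; [exact: cf|exact: cvg_cst].
  move=> /existsNP[m /contrapT fin1].
  apply: (split_at p (fun y => 1 / 3 - f y)) => //; last 2 first.
  - by rewrite fp; lra.
  (* Every [y] has [f y < 2/3] or [f y > 1/3]. If the two sides failed at stages [m] and [n], the
     support of [u] would meet [C (maxn m n)] in a finite set. *)
  - move=> n fin2; apply: (iu (maxn m n)).
    apply: (@sub_finite_set _ _ ((C m `&` E1) `|` (C n `&` E2))); last first.
      by rewrite finite_setU.
    move=> y [Cy uy]; have [fy|fy] := ltP (f y) (2 / 3).
      left; split; first by apply: mC Cy; exact: leq_maxl.
      by split=> //=; lra.
    right; split; first by apply: mC Cy; exact: leq_maxr.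
    by split=> //=; lra.
  - by move=> y; apply: cvgB; [exact: cvg_cst|exact: cf].
have ok1 : ok (fun=> 1).
  split; first by move=> y; exact: cvg_cst.
  move=> n; rewrite (_ : [set _ | _] = setT) ?setIT//.
  by apply/seteqP; split=> y //= _; exact: oner_neq0.
have /choice[next nextP] : forall ku : nat * {u | ok u},
    exists q : X * (X -> R) * {u | ok u},
      [/\ C ku.1 q.1.1, continuous q.1.2, q.1.2 q.1.1 != 0,
          forall y, sval ku.2 y = 0 -> q.1.2 y = 0 /\ sval q.2 y = 0 &
          forall y, q.1.2 y * sval q.2 y = 0].
  by move=> [k u]; exact: step.
pose fix st n := if n is m.+1 then (next (m, st m)).2 else exist ok _ ok1.
pose x k := (next (k, st k)).1.1; pose g k := (next (k, st k)).1.2.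
have st0 j k y : (j <= k)%N -> sval (st j) y = 0 -> sval (st k) y = 0.
  elim: k => [|k IH]; first by rewrite leqn0 => /eqP->.
  rewrite leq_eqVlt => /predU1P[->//|jk /(IH jk) sk].
  by have [_ _ _ /(_ _ sk)[]] := nextP (k, st k).
have gg j k y : (j < k)%N -> g j y * g k y = 0.
  (* Where [g j] is nonzero, the function left after step [j] vanishes, and so do all later
     bumps. *)
  move=> jk; have [_ _ _ _ /(_ y)/eqP] := nextP (j, st j).
  rewrite mulf_eq0 => /predU1P[|/eqP s0]; first by rewrite /g => ->; rewrite mul0r.
  have [_ _ _ /(_ y (st0 j.+1 _ _ jk s0))[g0 _] _] := nextP (k, st k).
  by rewrite /g g0 mulr0.
exists x, g; split=> [k|k|k|j k y].
- by have [] := nextP (k, st k).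
- by have [] := nextP (k, st k).
- by have [] := nextP (k, st k).
- by rewrite neq_ltn => /orP[/gg//|/gg]; rewrite mulrC.
Qed.

Lemma fundamental_bounded_resolution_countable (R : realType)
    (X : topologicalType) (B : (nat -> nat) -> set (X -> R)) :
  tychonoff_space X -> fundamental_bounded_resolution B -> countable [set: X].
Proof.
move=> tX fB; apply: contrapT => ncX.
(* The size of the prefix doubles as the bound, so c codes the prefix alone. *)
pose T c x := if @unpickle (seq nat) c is Some s then
  forall b f, (forall i, (i < size s)%N -> b i = nth 0%N s i) -> B b f ->
    `|f x| <= (size s)%:R else False.
have [x infC] := uncountable_infinite_classes T ncX.
have [|||y [g [Cy cg gy gg]]] := @disjoint_bumps R X
  (fun n => [set y | forall c, (c < n)%N -> T c y <-> T c x]) => //.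
  by move=> n y Cy c cn; apply: Cy; rewrite ltnS ltnW.
pose h k z := k%:R / g k (y k) * g k z.
have [_ _ _ /(_ (range h))[|a ha]] := fB.
  apply/Cp_boundedP; split=> [_ [k _ <-] z|z].
    by apply: cvgM; [exact: cvg_cst|exact: cg].
  (* At most one [g k] is nonzero at [z], so a single value bounds the whole family there. *)
  have [[k gk]|/forallNP g0] := pselect (exists k, g k z != 0).
    exists `|h k z| => _ [j _ <-]; have [->//|jk] := eqVneq j k.
    have /eqP := gg _ _ z jk.
    by rewrite mulf_eq0 (negbTE gk) orbF /h => /eqP ->; rewrite mulr0 normr0.
  exists 0 => _ [j _ <-].
  by rewrite /h; have /negP := g0 j; rewrite negbK => /eqP ->; rewrite mulr0 normr0.
have [n Hn] := uniform_bound_on_prefix fB a x.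
have Tx : T (pickle (mkseq a n)) x.
  rewrite /T pickleK size_mkseq => b f ba; apply: Hn => i ni.
  by rewrite ba// nth_mkseq.
(* Beyond the code of the prefix, [y k] inherits the bound [n] from [x]; beyond [n], the value [k]
   of [h k] at [y k] violates it. *)
pose k := maxn (pickle (mkseq a n)).+1 n.+1.
have : `|h k (y k)| <= n%:R.
  have /(Cy k)[_ /(_ Tx)] : (pickle (mkseq a n) < k)%N by rewrite leq_max leqnn.
  rewrite /T pickleK size_mkseq; apply; last by apply: ha; exists k.
  by move=> i ni; rewrite nth_mkseq.
by rewrite /h divfK// ger0_norm// ler_nat leqNgt leq_max leqnn orbT.
Qed.

Lemma countable_fundamental_bounded_resolution (R : realType)
    (X : topologicalType) :
  countable [set: X] ->
  exists B : (nat -> nat) -> set (X -> R), fundamental_bounded_resolution B.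
Proof.
move=> /countable_injP[code codeI].
exists (fun a => [set f | continuous f /\ forall x, `|f x| <= (a (code x))%:R]).
have cover (M : X -> R) : exists a : nat -> nat, forall x, M x <= (a (code x))%:R.
  have /choice[a aP] : forall n, exists m : nat,
      forall x, code x = n -> M x <= m%:R.
    move=> n; have [[x xn]|nx] := pselect (exists x, code x = n); last first.
      by exists 0%N => x xn; exfalso; apply: nx; exists x.
    exists (Num.truncn (M x)).+1 => z zn.
    rewrite (codeI z x) ?inE ?zn//.
    exact/ltW/truncnS_gt.
  by exists a => x; exact: aP.
split.
- move=> a; apply/Cp_boundedP; split=> [f []//|x].
  by exists (a (code x))%:R => f [].
- apply/seteqP; split=> [f [a _ []]//|f cf].
  by have [a aP] := cover (fun x => `|f x|); exists a.
- move=> a b ab f [cf fa]; split=> // x.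
  by rewrite (le_trans (fa x))// ler_nat.
- move=> A /Cp_boundedP[AC /choice[M MP]].
  have [a aP] := cover M; exists a => f Af; split; first exact: AC.
  by move=> x; apply: le_trans (aP x); exact: MP.
Qed.

Theorem theorem3p2 (R : realType) (X : topologicalType) :
  tychonoff_space X ->
  ((exists B : (nat -> nat) -> set (X -> R), fundamental_bounded_resolution B)
   <-> countable [set: X]).
Proof.
move=> tX; split=> [[B]|].
  exact: fundamental_bounded_resolution_countable.
exact: countable_fundamental_bounded_resolution.
Qed.
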